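(* Let $K\subseteq\mathbb R^d$ be a compact convex polytope, and let $(\Phi_{\omega_n})_{n\ge1}$ be i.i.d. random piecewise affine self-maps of $K$. Set $\Phi_n:=\Phi_{\omega_n}\circ\cdots\circ\Phi_{\omega_1}$, $L_n:=L(\Phi_n;K)$ and $Z_n:=n^{-1}\log L_n$. Assume that $L_n$ is measurable for every $n\ge1$, and that $\sup_{\omega}L(\Phi_{\omega};K)\le B$ for some deterministic $B\ge1$. Then for every $q\in\mathbb R$ the limit $$\Lambda_{\mathrm{line}}(q):=\lim_{n\to\infty} n^{-1}\log\mathbb E[L_n^q]$$ exists. For $q\ge0$ one has $\Lambda_{\mathrm{line}}(q)=\inf_{n\ge1} n^{-1}\log\mathbb E[L_n^q]$, while for $q<0$ one has $\Lambda_{\mathrm{line}}(q)=\sup_{n\ge1} n^{-1}\log\mathbb E[L_n^q]$. Moreover, $\Lambda_{\mathrm{line}}$ is finite and convex on $\mathbb R$, and $\min\{0,q\log B\}\le \Lambda_{\mathrm{line}}(q)\le \max\{0,q\log B\}$ for all $q\in\mathbb R$. If $I_{\mathrm{line},+}(x):=\sup_{q\ge0}\{qx-\Lambda_{\mathrm{line}}(q)\}$ and $I_{\mathrm{line},-}(x):=\sup_{q\le0}\{qx-\Lambda_{\mathrm{line}}(q)\}$, then, for every $x\in\mathbb R$, $$\limsup_{n\to\infty} n^{-1}\log\mathbb P(Z_n\ge x)\le -I_{\mathrm{line},+}(x) \qquad\text{and}\qquad \limsup_{n\to\infty} n^{-1}\log\mathbb P(Z_n\le x)\le -I_{\mathr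m{line},-}(x).$$
   Context: A map is affine on a subset of $K$ if it agrees there with the restriction of an affine map on $\mathbb R^d$. A map $f:K\to K$ is called piecewise affine if there are finitely many compact convex polytopes $P_1,\dots,P_M\subseteq K$ whose union is $K$ and such that $f$ is affine on each $P_i$. For an interval $J$ and a map $f$ on $J$ (with values in $\mathbb R^d$), $A(f;J)$ denotes the smallest number of subintervals partitioning $J$ on each of which $f$ is affine. $\mathcal S(K)$ denotes the family of affine maps $\gamma:[0,1]\to K$, including degenerate (constant) ones. For $f:K\to K$, the worst-line affine-piece count is $L(f;K):=\sup_{\gamma\in\mathcal S(K)}A(f\circ\gamma;[0,1])$. The random maps are given by i.i.d. random parameters $\omega_1,\omega_2,\dots$ and a family $(\Phi_\omega)_\omega$ of piecewise affine self-maps of $K$ indexed by the parameter space; $\sup_\omega$ is over the parameter space. Conventions: $\log 0=-\infty$; rate functions may take the value $+\infty$. *)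

(* Defs.v *)
From mathcomp Require Import all_boot all_order all_algebra.
From mathcomp Require Import all_classical all_reals all_analysis.
From mathcomp Require Import measurable_realfun.

Set Implicit Arguments.
Unset Strict Implicit.
Unset Printing Implicit Defensive.

Import Order.TTheory GRing.Theory Num.Theory.
Import numFieldNormedType.Exports.

Local Open Scope classical_set_scope.
Local Open Scope ring_scope.
Local Open Scope ereal_scope.

Definition affine_on (R : realType) (U V : lmodType R) (D : set U)
    (f : U -> V) : Prop :=
  exists (g : {linear U -> V}) (c : V), forall x, D x -> f x = (g x + c)%R.

(* Convex hull of finitely many points, hence automatically compact. The case
   n = 0 makes set0 a polytope; nonemptiness of the ambient polytope is a
   separate hypothesis of the theorem. *)
Definition polytope (R : realType) (V : lmodType R) (Q : set V) : Prop :=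
  exists (n : nat) (v : 'I_n -> V),
    Q = [set x | exists c : 'I_n -> R,
           [/\ forall i, (0 <= c i)%R, (\sum_i c i)%R = 1%R &
               x = (\sum_i c i *: v i)%R]].

(* A self-map of K is represented by a total function preserving K; its values
   outside K are irrelevant. *)
Definition piecewise_affine_self_map (R : realType) (V : lmodType R)
    (K : set V) (f : V -> V) : Prop :=
  f @` K `<=` K /\
  exists (M : nat) (Q : 'I_M -> set V),
    [/\ forall i, polytope (Q i) /\ Q i `<=` K,
        \bigcup_i Q i = K &
        forall i, affine_on (Q i) f].

(* The subintervals may be open, closed, half-open or reduced to a point. *)
Definition affine_partition (R : realType) (V : lmodType R) (f : R^o -> V)
    (J : interval R) (n : nat) : Prop :=
  exists F : 'I_n -> interval R,
    partition [set: 'I_n] (fun i => [set` F i]) [set` J] /\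
    (forall i, affine_on ([set` F i] : set R^o) f).

(* A(f; J), with value +oo when no finite partition exists. *)
Definition affine_pieces (R : realType) (V : lmodType R) (f : R^o -> V)
    (J : interval R) : \bar R :=
  ereal_inf [set n%:R%:E | n in [set n | affine_partition f J n]].

(* S(K); a segment is a function on R of which only the values on [0, 1]
   matter. *)
Definition segments (R : realType) (V : lmodType R) (K : set V) :
    set (R^o -> V) :=
  [set gamma | affine_on ([set` `[0%R, 1%R]] : set R^o) gamma /\
               (forall t : R, t \in `[0%R, 1%R] -> K (gamma t))].

Definition line_count (R : realType) (V : lmodType R) (f : V -> V)
    (K : set V) : \bar R :=
  ereal_sup [set affine_pieces (f \o gamma) `[0%R, 1%R]
            | gamma in segments K].

(* [:: w_1; ...; w_n] |-> Phi_{w_n} \o ... \o Phi_{w_1} *)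
Definition compose_maps (Theta V : Type) (Phi : Theta -> V -> V)
    (s : seq Theta) : V -> V :=
  foldl (fun f w => Phi w \o f) id s.

Section Random.
Context (R : realType) (dT dO : measure_display) (Theta : measurableType dT)
  (Omega : measurableType dO) (P : probability Omega R).

Definition mutually_independent (X : nat -> Omega -> Theta) : Prop :=
  forall (s : seq nat) (A : nat -> set Theta), uniq s ->
    (forall i, i \in s -> measurable (A i)) ->
    P (\bigcap_(i in [set` s]) (X i @^-1` A i)) =
    \prod_(i <- s) P (X i @^-1` A i).

Definition identically_distributed (X : nat -> Omega -> Theta) : Prop :=
  forall (i j : nat) (A : set Theta), measurable A ->
    P (X i @^-1` A) = P (X j @^-1` A).

Definition iid (X : nat -> Omega -> Theta) : Prop :=
  [/\ forall i, measurable_fun [set: Omega] (X i),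
      mutually_independent X & identically_distributed X].

Context (V : lmodType R) (K : set V) (Phi : Theta -> V -> V)
  (omega : nat -> Omega -> Theta).

(* omega is indexed from 0: omega i is the (i+1)-st random parameter. *)
Definition Phi_n (n : nat) (w : Omega) : V -> V :=
  compose_maps Phi [seq omega i w | i <- iota 0 n].

Definition L_n (n : nat) (w : Omega) : \bar R := line_count (Phi_n n w) K.

Definition Z_n (n : nat) (w : Omega) : \bar R :=
  (n%:R^-1)%:E * lne (L_n n w).

(* Measurability of L_n as a function of the parameters (w_1, ..., w_n), for
   the product sigma-algebra. On the canonical space of parameter sequences
   this is the measurability of the random variable L_n; on an arbitrary
   Omega it is what makes the counts of disjoint blocks of the sequence
   measurable, independent and stationary. *)
Definition measurable_line_counts : Prop :=
  forall n : nat, (1 <= n)%N ->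
    measurable_fun [set: n.-tuple Theta]
      (fun t : n.-tuple Theta => line_count (compose_maps Phi t) K).

Definition log_moment (q : R) (n : nat) : \bar R :=
  (n%:R^-1)%:E * lne (\int[P]_w (L_n n w `^ q)).

Definition Lambda_line (q : R) : \bar R := limn (log_moment q).

Definition I_line_plus (x : R) : \bar R :=
  ereal_sup [set (q * x)%:E - Lambda_line q | q in [set q : R | (0 <= q)%R]].

Definition I_line_minus (x : R) : \bar R :=
  ereal_sup [set (q * x)%:E - Lambda_line q | q in [set q : R | (q <= 0)%R]].

End Random.

(* Main.v *)
(* A segment is cut by f into at most L(f) pieces, each of which f maps affinely
   into K; since K is closed, each image extends to a segment of K, which g cuts
   into at most L(g) pieces. Hence L(g o f) <= L(f) L(g). Applied to two
   consecutive blocks of maps, which are independent, this makes log E[L_n^q]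
   subadditive in n for q >= 0 and superadditive for q < 0, so Fekete's lemma
   gives the limit; 1 <= L_n <= B^n gives the bounds. Convexity in q passes to
   the limit from log E[L_n^q], and the tail bounds are Markov's inequality
   applied to L_n^q for every q of the relevant sign. *)
Require Import Defs.
From mathcomp Require Import all_boot all_order all_algebra.
From mathcomp Require Import all_classical all_reals all_analysis.
From mathcomp Require Import measurable_realfun ring lra.

Set Implicit Arguments.
Unset Strict Implicit.
Unset Printing Implicit Defensive.

Import Order.TTheory GRing.Theory Num.Theory.
Import numFieldNormedType.Exports.
Local Open Scope classical_set_scope.
Local Open Scope ring_scope.
Local Open Scope ereal_scope.

(** The geometric obstacle is that a piece cut out by [f] may be open, half-open or a point, while a
    bound on [g] speaks only of segments parametrized by all of [0, 1]. The affine formula of the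
    piece is therefore prolonged to the extreme times at which it still lies in [K], the resulting
    segment is cut by [g], and the cuts are pulled back to the piece. Some pulled-back cuts can be
    empty, and their number varies from piece to piece; hence the detour through covers with a fixed
    finite index type.

    The probabilistic obstacle is that [Omega] carries no shift, so the count of a later block is
    not [L_n] evaluated at another sample point. Counts are treated as functions of tuples of
    parameters, and laws of blocks are compared on rectangles. Independence alone would not suffice:
    equality in law of blocks of the same length is what turns the moment of the second block into
    that of [L_n] for its length.

    All analysis is done with the real variable [log L_n]. The limit theory sees only variables
    between 0 and [n * c] whose cumulants are sub- or superadditive. *)

(** * Polytopes, affine covers and submultiplicativity of line counts *)

Lemma polytope_convex (R : realType) (V : lmodType R) (K : set V) x y (s : R) :
  polytope K -> K x -> K y -> (0 <= s <= 1)%R ->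
  K (x + s *: (y - x))%R.
Proof.
move=> [n [v ->]] [c [c0 c1 ->]] [c' [c'0 c'1 ->]] /andP[s0 s1].
exists (fun i => (1 - s) * c i + s * c' i)%R; split.
- by move=> i; rewrite addr_ge0// mulr_ge0// subr_ge0.
- by rewrite big_split/= -!mulr_sumr c1 c'1 !mulr1 subrK.
- rewrite -sumrB scaler_sumr -big_split/=; apply: eq_bigr => i _.
  by rewrite scalerBr !scalerA -scalerBl -scalerDl; congr (_ *: _)%R; ring.
Qed.

(* The parameter t and the barycentric coordinates of the point G t + c range
   over one compact subset of 'rV_n.+1, on which the first coordinate t attains
   its extrema. *)
Lemma polytope_line_extrema (R : realType) (d : nat) (K : set 'rV[R]_d)
    (G : {linear R^o -> 'rV[R]_d}) (c : 'rV[R]_d) (J : set R) :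
  polytope K -> J !=set0 -> J `<=` `[0%R, 1%R] ->
  (forall t, J t -> K (G t + c)%R) ->
  exists a b : R, [/\ K (G a + c)%R, K (G b + c)%R &
    forall t, J t -> (a <= t <= b)%R].
Proof.
move=> [n [v Kv]] J0 J01 JK.
pose S := [set x : 'rV[R]_n.+1 |
  [/\ forall i, `[0%R, 1%R]%classic (x ord0 i),
      (\sum_(i < n) x ord0 (lift ord0 i))%R = 1%R &
      (\sum_(i < n) x ord0 (lift ord0 i) *: v i)%R = (G (x ord0 ord0) + c)%R]].
have cont_coord k (j : 'I_k) : continuous (fun x : 'rV[R]_k => x ord0 j).
  exact: coord_continuous.
have SK x : S x -> K (G (x ord0 ord0) + c)%R.
  move=> [x01 x1 xv]; rewrite Kv; exists (fun i => x ord0 (lift ord0 i)).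
  by split => // i; have /= := x01 (lift ord0 i); rewrite in_itv => /andP[].
have KS t : J t -> exists2 x, S x & x ord0 ord0 = t.
  move=> Jt; have := JK _ Jt; rewrite Kv => -[a [a0 a1 aE]].
  pose w : 'rV[R]_n.+1 := row_mx (t%:M : 'M[R]_1) (\row_i a i).
  have w0 : w ord0 ord0 = t.
    have -> : (ord0 : 'I_n.+1) = lshift n (ord0 : 'I_1) by exact: val_inj.
    by rewrite /w (@row_mxEl _ 1 1 n) mxE eqxx mulr1n.
  have wS i : w ord0 (lift ord0 i) = a i.
    have -> : lift ord0 i = rshift 1 i by exact: val_inj.
    by rewrite /w (@row_mxEr _ 1 1 n) mxE.
  exists w => //; split; last by rewrite w0 aE; under eq_bigr do rewrite wS.
    move=> i; case: (unliftP ord0 i) => [j ->|->].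
      rewrite wS /= in_itv/= a0/= -a1 (bigD1 j)//= lerDl.
      exact: sumr_ge0.
    by rewrite w0; exact: J01.
  by under eq_bigr do rewrite wS.
have cS : compact S.
  (* [G] is only known to be linear; writing [G t] as [t *: G 1] turns each coordinate of the last
     equation defining [S] into a level set of the continuous function [H j]. *)
  pose H := fun (j : 'I_d) (x : 'rV[R]_n.+1) =>
    (\sum_(i < n) x ord0 (lift ord0 i) * v i ord0 j
     - x ord0 ord0 * G 1%R ord0 j)%R.
  have cM j (k : R) : continuous (fun x : 'rV[R]_n.+1 => x ord0 j * k)%R.
    by move=> x; apply: continuousM; [exact: cont_coord|exact: cst_continuous].
  have cS (F : 'I_n -> 'rV[R]_n.+1 -> R) : (forall i, continuous (F i)) ->
      continuous (fun x => \sum_(i < n) F i x)%R.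
    move=> cF; apply: continuous_big => [x|i _]; last exact: cF.
    exact: add_continuous.
  have cB (f g : 'rV[R]_n.+1 -> R) : continuous f -> continuous g ->
      continuous (fun x => f x - g x)%R.
    by move=> cf cg x; apply: (cvgB (cf x) (cg x)).
  have cH j : continuous (H j).
    by apply: cB; [apply: cS => i; exact: cM|exact: cM].
  have -> : S = [set x : 'rV[R]_n.+1 |
      forall i, `[0%R, 1%R]%classic (x ord0 i)] `&`
      ((fun x : 'rV[R]_n.+1 => (\sum_(i < n) x ord0 (lift ord0 i))%R)
         @^-1` [set 1%R] `&`
       \bigcap_j (H j @^-1` [set c ord0 j])).
    apply/seteqP; split=> x.
      move=> [x01 x1 /rowP xv]; split => //; split => // j _ /=.
      rewrite /H; have := xv j.
      rewrite summxE mxE -{1}[x ord0 ord0]mulr1 linearZ_LR/= mxE.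
      move=> /(congr1 (fun z => z - x ord0 ord0 * G 1%R ord0 j)%R).
      rewrite [(_ + c ord0 j)%R]addrC addrK => <-; congr (_ - _)%R.
      by apply: eq_bigr => i _; rewrite mxE.
    move=> [x01 [x1 xH]]; split => //; apply/rowP => j.
    have /= := xH j I; rewrite /H => /eqP; rewrite subr_eq => /eqP.
    rewrite summxE mxE -{2}[x ord0 ord0]mulr1 linearZ_LR/= mxE addrC => <-.
    by apply: eq_bigr => i _; rewrite mxE.
  apply: compact_closedI.
    apply: (@rV_compact R n.+1 (fun=> `[0%R, 1%R]%classic)) => _.
    exact: segment_compact.
  apply: closedI.
    apply: preimage_closed => [x _|]; last exact: closed_eq.
    by apply: cS => i; exact: cont_coord.
  apply: closed_bigI => j _.
  by apply: preimage_closed => [x _|]; [exact: cH|exact: closed_eq].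
have S0 : S !=set0 by case: J0 => t /KS[x Sx _]; exists x.
have c0 : {within S, continuous (fun x : 'rV[R]_n.+1 => x ord0 ord0)}.
  exact/continuous_subspaceT/cont_coord.
have [xa] := compact_EVT_min S0 cS c0; rewrite inE => Sa amin.
have [xb] := compact_EVT_max S0 cS c0; rewrite inE => Sb bmax.
exists (xa ord0 ord0), (xb ord0 ord0); split; [exact: SK|exact: SK|].
by move=> t /KS[x Sx <-]; rewrite amin ?bmax ?inE.
Qed.

(* Unlike in affine_partition, members may be empty. *)
Definition affine_cover (R : realType) (V : lmodType R) (T : finType)
    (f : R^o -> V) (A : set R) (F : T -> interval R) : Prop :=
  [/\ trivIset [set: T] (fun t => [set` F t]), \bigcup_t [set` F t] = A &
      forall t, affine_on ([set` F t] : set R^o) f].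

(** Discarding the empty members of the cover leaves a genuine partition, and this can only lower
    their number. *)
Lemma affine_cover_partition (R : realType) (V : lmodType R) (T : finType)
    (f : R^o -> V) (J : interval R) (F : T -> interval R) :
  affine_cover f [set` J] F ->
  exists2 n, (n <= #|T|)%N & affine_partition f J n.
Proof.
move=> [tF cF aF]; pose D : pred T := fun t => `[< [set` F t] !=set0 >].
exists #|D|; first exact: max_card.
exists (F \o enum_val); split; last by move=> i; exact: aF.
split.
- rewrite -cF; apply/seteqP; split=> x [t _ /= Ft].
    by exists (enum_val t).
  have Dt : t \in D by rewrite /D unfold_in; apply/asboolP; exists x.
  by exists (enum_rank_in Dt t) => //=; rewrite enum_rankK_in.
- by move=> i j _ _ /(tF _ _ I I) /enum_val_inj.
- by move=> i _; have := enum_valP i; rewrite unfold_in => /asboolP.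
Qed.

Lemma affine_on0 (R : realType) (U V : lmodType R) (f : U -> V) :
  affine_on set0 f.
Proof. by exists \0%R, 0%R. Qed.

(** Padding with the empty interval []0, 0[] brings the number of members to exactly [l]. The pieces
    of different segments can then share one index type. *)
Lemma partition_affine_cover (R : realType) (V : lmodType R) (f : R^o -> V)
    (J : interval R) (n l : nat) :
  (n <= l)%N -> affine_partition f J n ->
  exists F : 'I_l -> interval R, affine_cover f [set` J] F.
Proof.
move=> nl [F [[cF tF _] aF]].
pose G (j : 'I_l) := if insub (val j) is Some i then F i else `]0%R, 0%R[.
have GE (j : 'I_l) x : x \in G j -> exists2 i : 'I_n, val i = val j & x \in F i.
  rewrite /G; case: insubP => [i _ <-|_]; first by exists i.
  by rewrite in_itv/= lt_asym.
exists G; split.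
- move=> j1 j2 _ _ [x [/= /GE[i1 e1 x1] /GE[i2 e2 x2]]].
  have e : i1 = i2 by apply: tF => //; exists x.
  by apply: val_inj; rewrite -e1 -e2 e.
- rewrite -cF; apply/seteqP; split=> x [j _ /= xj].
    by have [i _ xi] := GE _ _ xj; exists i.
  by exists (widen_ord nl j) => //=; rewrite /G /= valK.
- move=> j; rewrite /G; case: insubP => [i _ _|_]; first exact: aF.
  by rewrite set_itvoo0; exact: affine_on0.
Qed.

(** An upper bound on the line count in a form that hands out actual partitions, with no infimum or
    supremum to unpack. *)
Definition line_bound (R : realType) (V : lmodType R) (f : V -> V) (K : set V)
    (k : nat) : Prop :=
  forall gamma, segments K gamma ->
    exists2 n, (n <= k)%N & affine_partition (f \o gamma) `[0%R, 1%R] n.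

(** On [J] the map [h] runs along part of the segment [gam] of [K] that joins the two extreme
    points. Up to the affine reparametrization [phi], the cover of [g \o gam] on [0, 1] restricts to
    the required cover of [J]. *)
Lemma affine_cover_comp (R : realType) (d : nat) (K : set 'rV[R]_d)
    (g : 'rV[R]_d -> 'rV[R]_d) (l : nat) (h : R^o -> 'rV[R]_d)
    (J : interval R) :
  polytope K -> line_bound g K l ->
  [set` J] !=set0 -> [set` J] `<=` `[0%R, 1%R] ->
  affine_on ([set` J] : set R^o) h -> (forall t, t \in J -> K (h t)) ->
  exists F : 'I_l -> interval R, affine_cover (g \o h) [set` J] F.
Proof.
move=> Kpoly gl J0 J01 [G [c hE]] hK.
have [t Jt|a [b [Ka Kb Jab]]] :=
    polytope_line_extrema (G := G) (c := c) Kpoly J0 J01.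
  by rewrite -hE//; exact: hK.
pose eta (t : R) := (G t + c)%R.
pose gam (s : R^o) : 'rV[R]_d := eta (a + s * (b - a))%R.
have GZ (r s : R) : G (r * s)%R = (r *: G s)%R.
  by rewrite -[X in G X]/(r *: (s : R^o))%R linearZ_LR.
have gamE s : gam s = (eta a + s *: (eta b - eta a))%R.
  rewrite /gam /eta linearD GZ linearB/=.
  by rewrite opprD addrACA subrr addr0 addrAC.
have [n nl pn] : exists2 n, (n <= l)%N &
    affine_partition (g \o gam) `[0%R, 1%R] n.
  apply: gl; split.
    exists ((b - a)%R \*: G)%R, (eta a).
    move=> s _; rewrite /gam /eta linearD mulrC GZ /=.
    by rewrite [(G a + _)%R]addrC -addrA.
  move=> s; rewrite in_itv/= => s01.
  by rewrite gamE; exact: polytope_convex.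
have [H [tH cH aH]] := partition_affine_cover nl pn.
(* If a = b then J is a singleton and phi is 0, since x / 0 = 0. *)
pose phi (t : R) := ((t - a) / (b - a))%R.
have phiK t : t \in J -> (a + phi t * (b - a))%R = t.
  move=> /Jab /andP[at' tb]; rewrite /phi.
  have [ab|ab] := eqVneq a b; last first.
    by rewrite divfK ?subr_eq0 1?eq_sym// addrC subrK.
  by apply/eqP; rewrite ab subrr mulr0 addr0 eq_le tb andbT -ab.
have phi01 t : t \in J -> (phi t \in `[0%R, 1%R])%R.
  move=> /Jab /andP[at' tb]; rewrite in_itv/= /phi.
  have [ab|ab] := eqVneq a b; first by rewrite ab subrr invr0 mulr0 lexx ler01.
  have ab' : (0 < b - a)%R.
    by rewrite subr_gt0 lt_neqAle ab (le_trans at' tb).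
  rewrite divr_ge0 ?subr_ge0 ?(le_trans at' tb)//=.
  by rewrite ler_pdivrMr// mul1r lerD2r.
have phi_le s t u : (s <= t <= u)%R -> s \in J -> (phi s <= phi t <= phi u)%R.
  move=> /andP[st tu] /Jab/andP[as' sb].
  by rewrite !ler_wpM2r ?lerD2r ?invr_ge0 ?subr_ge0 ?(le_trans as' sb).
pose P i : set R := [set t | t \in J /\ phi t \in H i].
have iP i : is_interval (P i).
  move=> s u [Js Hs] [Ju Hu] t stu; split.
    exact: (interval_is_interval Js Ju).
  by apply: (interval_is_interval Hs Hu); exact: phi_le.
have PE i : [set` Rhull (P i)] = P i by apply: RhullK; apply/asboolP.
(* A cover consists of terms of type [interval R], whereas [P i] is a set. It is order-convex
   because [phi] is monotone on [J], hence equal to its interval hull. *)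
exists (fun i => Rhull (P i)); split.
- move=> i j _ _; rewrite !PE => -[t [[Jt ti] [_ tj]]].
  by apply: tH => //; exists (phi t).
- under eq_bigcupr do rewrite PE.
  apply/seteqP; split=> t; first by case=> i _ [].
  move=> Jt; have : [set` `[0%R, 1%R]] (phi t) by exact: phi01.
  by rewrite -cH => -[i _ ti]; exists i.
- move=> i; rewrite PE; have [A [e AE]] := aH i.
  exists (((b - a)^-1)%R \*: A)%R, (e - (b - a)^-1 *: A a)%R.
  move=> t [Jt ti]; have /= := AE _ ti.
  rewrite /gam phiK// -/(eta t) => gE.
  rewrite /= hE// -/(eta t) gE /phi mulrC.
  rewrite -[((b - a)^-1 * (t - a))%R]/((b - a)^-1 *: (t - a : R^o))%R.
  by rewrite linearZ_LR/= linearB/= scalerBr addrAC addrA.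
Qed.

(** Every piece of [f \o gamma] receives a cover indexed by the same ['I_l], so all of them form a
    single family indexed by pairs. *)
Lemma line_bound_comp (R : realType) (d : nat) (K : set 'rV[R]_d)
    (f g : 'rV[R]_d -> 'rV[R]_d) (k l : nat) :
  polytope K -> f @` K `<=` K -> line_bound f K k -> line_bound g K l ->
  line_bound (g \o f) K (k * l).
Proof.
move=> Kpoly fK fk gl gamma Sgamma.
have [n nk [F [[cF tF F0] aF]]] := fk _ Sgamma.
have F01 i : [set` F i] `<=` `[0%R, 1%R] by rewrite -cF => t; exists i.
have /choice[H HF] i :
    exists H : 'I_l -> interval R,
      affine_cover (g \o (f \o gamma)) [set` F i] H.
  apply: (affine_cover_comp Kpoly gl (F0 i I) (F01 i) (aF i)) => t ti.
  by apply: fK; exists (gamma t) => //; apply: Sgamma.2; exact: F01 ti.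
have [|m mn pm] := @affine_cover_partition _ _ ('I_n * 'I_l)%type
    ((g \o f) \o gamma) `[0%R, 1%R] (fun p => H p.1 p.2).
  split.
  - move=> [i1 j1] [i2 j2] _ _ [/= t [t1 t2]].
    have [T1 C1 _] := HF i1; have [_ C2 _] := HF i2.
    have e : i1 = i2.
      apply: tF => //; exists t; split; rewrite -?C1 -?C2; first by exists j1.
      by exists j2.
    by subst i2; congr (_, _); apply: T1 => //; exists t.
  - rewrite -cF; apply/seteqP; split=> [t [[i j] _ /= tij]|t [i _ ti]].
      by exists i => //; have [_ <- _] := HF i; exists j.
    have [_ C _] := HF i; rewrite -C in ti.
    by case: ti => j _ tj; exists (i, j).
  - by move=> [i j]; have [_ _] := HF i; apply.
exists m => //; rewrite (leq_trans mn)// card_prod !card_ord leq_mul2r.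
by rewrite nk orbT.
Qed.

Lemma line_bound_count (R : realType) (V : lmodType R) (f : V -> V) (K : set V)
    (k : nat) : line_bound f K k -> line_count f K <= k%:R%:E.
Proof.
move=> fk; apply: ge_ereal_sup => _ [gamma /fk[n nk pn] <-].
apply: le_trans (_ : n%:R%:E <= _); last by rewrite lee_fin ler_nat.
by apply: ereal_inf_lbound; exists n.
Qed.

Lemma line_count_bound (R : realType) (V : lmodType R) (f : V -> V) (K : set V)
    (c : R) : line_count f K <= c%:E -> line_bound f K (Num.truncn c).
Proof.
move=> fc gamma Sgamma.
(* A strict upper bound is needed to extract a member from the infimum; an integer below
   [(Num.truncn c).+1] is at most [Num.truncn c]. *)
have : affine_pieces (f \o gamma) `[0%R, 1%R] < (Num.truncn c).+1%:R%:E.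
  apply: (@le_lt_trans _ _ c%:E); last by rewrite lte_fin truncnS_gt.
  by apply: le_trans fc; apply: ereal_sup_ubound; exists gamma.
move=> /ereal_inf_lt[_ [n pn <-]]; rewrite lte_fin ltr_nat ltnS => nc.
by exists n.
Qed.

(** A constant segment at a point of [K] already needs one piece, since [0, 1] is nonempty. *)
Lemma line_count_ge1 (R : realType) (V : lmodType R) (f : V -> V) (K : set V) :
  K !=set0 -> 1 <= line_count f K.
Proof.
move=> [x Kx]; 
apply: (@le_trans _ _ (affine_pieces (f \o cst x) `[0%R, 1%R])); last first.
  apply: ereal_sup_ubound; exists (cst x) => //.
  by split => //; exists \0%R, x => t _; rewrite /= add0r.
apply: le_ereal_inf_tmp => _ [n [F [[cF _ _] _]] <-].
rewrite lee_fin ler1n lt0n; apply/eqP => n0; subst n.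
have : [set` `[0%R, 1%R]] (0%R : R) by rewrite /= in_itv/= lexx ler01.
by rewrite -cF => -[[]].
Qed.

(** Both counts are positive, so an infinite one makes the product [+oo]. A finite count equals its
    own integer part, which reduces the claim to integer bounds. *)
Lemma line_count_comp (R : realType) (d : nat) (K : set 'rV[R]_d)
    (f g : 'rV[R]_d -> 'rV[R]_d) :
  polytope K -> K !=set0 -> f @` K `<=` K ->
  line_count (g \o f) K <= line_count f K * line_count g K.
Proof.
move=> Kpoly K0 fK.
have count_gt0 h : 0 < line_count h K.
  by apply: lt_le_trans (line_count_ge1 h K0); rewrite lte01.
have [|] := leP +oo (line_count f K).
  by rewrite leye_eq => /eqP ->; rewrite gt0_mulye// leey.
have [|] := leP +oo (line_count g K).
  by rewrite leye_eq => /eqP -> _; rewrite gt0_muley// leey.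
move=> goo foo.
have fin h : line_count h K < +oo ->
    exists2 k, line_bound h K k & line_count h K = k%:R%:E.
  move=> hoo; have hfin : line_count h K \is a fin_num.
    by rewrite ge0_fin_numE// ltW.
  have hb : line_bound h K (Num.truncn (fine (line_count h K))).
    by apply: line_count_bound; rewrite fineK.
  exists (Num.truncn (fine (line_count h K))) => //.
  apply/eqP; rewrite eq_le line_bound_count//= -[leRHS](fineK hfin) lee_fin.
  by rewrite truncn_le fine_ge0// (ltW (count_gt0 h)).
have [k fk ->] := fin _ foo; have [l gl ->] := fin _ goo.
by rewrite -EFinM -natrM; apply/line_bound_count/line_bound_comp.
Qed.

(** * Independence and stationarity of blocks of parameters *)

(** The hypothesis gives the joint law of [X] and [Y] on rectangles, hence identifies it with the
    product of the two laws; Tonelli then separates the integrals. *)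
Lemma integral_indep_prod (R : realType) d0 (Omega : measurableType d0)
    (P : probability Omega R)
    d1 d2 (T1 : measurableType d1) (T2 : measurableType d2)
    (X : {mfun Omega >-> T1}) (Y : {mfun Omega >-> T2})
    (F : T1 -> \bar R) (G : T2 -> \bar R) :
  (forall A C, measurable A -> measurable C ->
    P ((X @^-1` A) `&` (Y @^-1` C)) = P (X @^-1` A) * P (Y @^-1` C)) ->
  measurable_fun [set: T1] F -> measurable_fun [set: T2] G ->
  (forall x, 0 <= F x) -> (forall y, 0 <= G y) ->
  \int[P]_w (F (X w) * G (Y w)) = \int[P]_w F (X w) * \int[P]_w G (Y w).
Proof.
move=> XY mF mG F0 G0.
have mXY : measurable_fun setT (fun w => (X w, Y w)).
  by apply/measurable_fun_pair => //; exact: measurable_funP.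
pose Z : {mfun Omega >-> (T1 * T2)%type} := mfun_Sub (mem_set mXY).
pose H (p : T1 * T2) := F p.1 * G p.2.
have mH : measurable_fun setT H.
  by apply: emeasurable_funM; [exact: measurableT_comp|exact: measurableT_comp].
have H0 p : 0 <= H p by exact: mule_ge0.
transitivity (\int[distribution P Z]_p H p).
  by rewrite ge0_integral_distribution.
transitivity (\int[distribution P X \x distribution P Y]_p H p).
  apply: eq_measure_integral => A mA _; apply/esym.
  by apply: product_measure_unique => // B C mB mC; exact: XY.
rewrite fubini_tonelli1// /fubini_F/=.
transitivity (\int[distribution P X]_x (F x * \int[distribution P Y]_y G y)).
  by apply: eq_integral => x _; rewrite -ge0_integralZl.
rewrite ge0_integralZr ?integral_ge0//.
by rewrite !ge0_integral_distribution.
Qed.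

(** The sides are indexed by [nat], so that rectangles of different lengths can be glued and the
    independence hypothesis applies directly. *)
Definition tuple_rect (n : nat) (T : Type) (B : nat -> set T) :
    set (n.-tuple T) := [set t | forall i : 'I_n, B i (tnth t i)].

Arguments tuple_rect n {T} B.

Lemma measurable_tuple_rect d (T : measurableType d) (n : nat)
    (B : nat -> set T) :
  (forall i, measurable (B i)) -> measurable (tuple_rect n B).
Proof.
move=> mB; rewrite (_ : tuple_rect n B =
  \bigcap_(i in [set: 'I_n]) [set t : n.-tuple T | B i (tnth t i)]).
  apply: fin_bigcap_measurable => [|i _]; first exact: finite_finset.
  by rewrite -[X in measurable X]setTI; exact: measurable_tnth.
by apply/seteqP; split=> [t Bt i _|t Bt i]; exact: Bt.
Qed.

(** Rectangles are stable under intersection and generate the product sigma-algebra, so finite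
    measures that agree on them coincide. *)
Lemma tuple_measure_unique (R : realType) d (T : measurableType d) (n : nat)
    (m1 m2 : {measure set (n.-tuple T) -> \bar R}) :
  m1 setT < +oo ->
  (forall B : nat -> set T, (forall i, measurable (B i)) ->
    m1 (tuple_rect n B) = m2 (tuple_rect n B)) ->
  forall A, measurable A -> m1 A = m2 A.
Proof.
move=> m1oo m12 A mA.
pose G := [set tuple_rect n B | B in
  [set B : nat -> set T | forall i, measurable (B i)]].
apply: (measure_unique G (fun=> setT)) => //.
- apply/seteqP; split.
    apply: smallest_sub; first exact: smallest_sigma_algebra.
    move=> C; rewrite -bigcup_seq/= => -[i _ [B mB <-]].
    apply: sub_sigma_algebra.
    (* The preimage of [B] under the [i]-th coordinate is the rectangle whose other sides are the
       full space. *)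
    exists (fun j => if j == i :> nat then B else setT).
      by move=> j; case: ifP.
    rewrite setTI; apply/seteqP; split=> t /=.
      by move=> /(_ i); rewrite eqxx.
    by move=> Bt j; case: ifP => // /eqP/val_inj ->.
  apply: smallest_sub; first exact: sigma_algebra_measurable.
  by move=> _ [B mB <-]; exact: measurable_tuple_rect.
- move=> _ _ [B mB <-] [C mC <-]; exists (fun i => B i `&` C i).
    by move=> i; exact: measurableI.
  apply/seteqP; split=> t; first by move=> BC; split=> i; have [] := BC i.
  by move=> [Bt Ct] i; split; [exact: Bt|exact: Ct].
- by move=> _; exists (fun=> setT) => //; apply/seteqP; split.
- by apply/seteqP; split => // t _; exists 0%N.
- by move=> _ [B mB <-]; exact: m12.
Qed.

Section blocks.
Context (R : realType) (dT dO : measure_display) (Theta : measurableType dT)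
  (Omega : measurableType dO) (P : probability Omega R)
  (omega : nat -> Omega -> Theta) (omega_iid : iid P omega).

Definition block (a n : nat) (w : Omega) : n.-tuple Theta :=
  [tuple omega (a + i)%N w | i < n].

Lemma measurable_block a n : measurable_fun [set: Omega] (block a n).
Proof.
apply/measurable_fun_tnthP => i; have [momega _ _] := omega_iid.
rewrite (_ : _ \o _ = omega (a + i)%N); first exact: momega.
by apply/funext => w /=; rewrite tnth_mktuple.
Qed.

Definition block_mfun a n : {mfun Omega >-> n.-tuple Theta} :=
  mfun_Sub (mem_set (@measurable_block a n)).

(** The right-hand side does not involve [a]; stationarity of blocks rests on this. *)
Lemma block_rect a n (B : nat -> set Theta) : (forall i, measurable (B i)) ->
  P (block a n @^-1` tuple_rect n B) = \prod_(i < n) P (omega 0 @^-1` B i).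
Proof.
move=> mB; have [momega indep ident] := omega_iid.
have -> : block a n @^-1` tuple_rect n B =
    \bigcap_(k in [set` iota a n]) (omega k @^-1` B (k - a)%N).
  apply/seteqP; split=> w.
    move=> wB k; rewrite /= mem_iota => /andP[ak kn].
    have kan : (k - a < n)%N by rewrite ltn_subLR.
    by have := wB (Ordinal kan); rewrite tnth_mktuple/= subnKC.
  move=> wB i; rewrite tnth_mktuple -[X in B X](addKn a).
  by apply: wB; rewrite /= mem_iota leq_addr ltn_add2l ltn_ord.
rewrite indep ?iota_uniq// -[X in iota X](addn0 a) iotaDl big_map.
rewrite -[X in iota 0 X](subn0 n) -/(index_iota 0 n) big_mkord.
by apply: eq_bigr => i _; rewrite addKn; exact: ident.
Qed.

Lemma block_law a n A : measurable A ->
  P (block a n @^-1` A) = P (block 0 n @^-1` A).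
Proof.
apply: (@tuple_measure_unique _ _ _ _ (distribution P (block_mfun a n))
  (distribution P (block_mfun 0 n))).
  by rewrite /= /distribution /pushforward preimage_setT probability_setT ltry.
by move=> B mB; rewrite [LHS]block_rect// [RHS]block_rect.
Qed.

Let measurable_block_preimage a n A :
  measurable A -> measurable (block a n @^-1` A).
Proof.
by move=> mA; rewrite -[X in measurable X]setTI; exact: measurable_block.
Qed.

(** For fixed [D], both sides are finite measures in [A], so agreement on rectangles is enough.
    Freezing one event at a time allows independence of two blocks to be upgraded from rectangles
    one side after the other. *)
Lemma block_indep_event a n D : measurable D ->
  (forall B : nat -> set Theta, (forall i, measurable (B i)) ->
    P ((block a n @^-1` tuple_rect n B) `&` D) =
    P (block a n @^-1` tuple_rect n B) * P D) ->
  forall A, measurable A ->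
    P ((block a n @^-1` A) `&` D) = P (block a n @^-1` A) * P D.
Proof.
move=> mD indB.
have PD : P D \is a fin_num by exact: fin_num_measure.
have [m1 m1E] : exists m : {measure set (n.-tuple Theta) -> \bar R},
    forall A, m A = P ((block a n @^-1` A) `&` D).
  unshelve eexists (pushforward (mrestr P mD) (block a n) :
    {measure set (n.-tuple Theta) -> \bar R}) => //; exact: measurable_block.
have PD0 : (0 <= fine (P D))%R by exact: fine_ge0.
pose m2 : {measure set (n.-tuple Theta) -> \bar R} :=
  mscale (NngNum PD0) (distribution P (block_mfun a n)).
have m2E A : m2 A = P (block a n @^-1` A) * P D.
  by rewrite /m2 /= /mscale /= fineK// muleC.
move=> A mA; rewrite -m1E -m2E; apply: tuple_measure_unique mA.
  by rewrite m1E preimage_setT setTI ltey_eq PD.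
by move=> B mB; rewrite m1E m2E indB.
Qed.

Lemma block_joint_law n m A C : measurable A -> measurable C ->
  P ((block 0 n @^-1` A) `&` (block n m @^-1` C)) =
  P (block 0 n @^-1` A) * P (block n m @^-1` C).
Proof.
move=> mA mC.
(* The second block is reduced to rectangles with the event of the first one frozen, and then the
   first block with the rectangle of the second one frozen. *)
rewrite setIC muleC; apply: block_indep_event mC.
  exact: measurable_block_preimage.
move=> C' mC'; rewrite setIC muleC; apply: block_indep_event mA.
  by apply: measurable_block_preimage; exact: measurable_tuple_rect.
(* Two rectangles on adjacent blocks form one rectangle on the joined block of length [n + m]. *)
move=> B mB; pose E k := if (k < n)%N then B k else C' (k - n)%N.
have mE k : measurable (E k) by rewrite /E; case: ifP.
have -> : (block 0 n @^-1` tuple_rect n B) `&`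
    (block n m @^-1` tuple_rect m C') =
    block 0 (n + m) @^-1` tuple_rect (n + m) E.
  apply/seteqP; split=> w.
    move=> [wB wC] i; rewrite tnth_mktuple add0n /E; case: ltnP => ni.
      by have := wB (Ordinal ni); rewrite tnth_mktuple.
    have im : (i - n < m)%N by rewrite ltn_subLR.
    by have := wC (Ordinal im); rewrite tnth_mktuple/= subnKC.
  move=> wE; split=> i.
    have := wE (lshift m i); rewrite !tnth_mktuple /E/= ltn_ord.
    exact.
  have := wE (rshift n i); rewrite !tnth_mktuple /E/= ltnNge leq_addr/=.
  by rewrite addKn.
rewrite !block_rect// big_split_ord/=; congr (_ * _); apply: eq_bigr => i _.
  by rewrite /E ltn_ord.
by rewrite /E ltnNge leq_addr/= addKn.
Qed.

Lemma integral_block_prod n m (F : n.-tuple Theta -> \bar R)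
    (G : m.-tuple Theta -> \bar R) :
  measurable_fun [set: n.-tuple Theta] F ->
  measurable_fun [set: m.-tuple Theta] G ->
  (forall t, 0 <= F t) -> (forall t, 0 <= G t) ->
  \int[P]_w (F (block 0 n w) * G (block n m w)) =
  \int[P]_w F (block 0 n w) * \int[P]_w G (block 0 m w).
Proof.
move=> mF mG F0 G0.
rewrite (integral_indep_prod (X := block_mfun 0 n)
  (Y := block_mfun n m))//; last first.
  by move=> A C mA mC; exact: block_joint_law.
congr (_ * _).
(* Stationarity moves the second block back to the start of the sequence. *)
transitivity (\int[distribution P (block_mfun n m)]_t G t).
  by rewrite ge0_integral_distribution.
transitivity (\int[distribution P (block_mfun 0 m)]_t G t); last first.
  by rewrite ge0_integral_distribution.
by apply: eq_measure_integral => A mA _; exact: block_law.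
Qed.

End blocks.

(** * Fekete's lemma for sequences that are controlled at positive indices only *)

Lemma fekete (R : realType) (a : nat -> R) (c : R) :
  (forall n m, (0 < n)%N -> (0 < m)%N -> a (n + m)%N <= a n + a m)%R ->
  (forall n, (0 < n)%N -> c <= n%:R^-1 * a n)%R ->
  (n%:R^-1 * a n)%R @[n --> \oo] -->
    inf [set (n%:R^-1 * a n)%R | n in [set n | (0 < n)%N]].
Proof.
move=> a_sub a_lb; set S := (X in inf X).
have infS : has_inf S.
  split; first by exists (1%:R^-1 * a 1%N)%R, 1%N.
  by exists c => _ [n n0 <-]; exact: a_lb.
apply/cvgrPdist_le => /= e e0.
have e20 : (0 < e / 2)%R by rewrite divr_gt0.
have [_ [k k0 <-] ak] := inf_adherent e20 infS.
have kR : (0 < k%:R :> R)%R by rewrite ltr0n.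
(* [M] absorbs two errors uniformly in [n]: the leftover term [a r] with [r <= k], and the change
   from [q * a k] to [n / k * a k], which is at most [|a k|]. *)
pose M := (\sum_(r < k.+1) `|a r| + `|a k|)%R.
have a_mul q r : (0 < r)%N -> (a (q * k + r)%N <= q%:R * a k + a r)%R.
  move=> r0; elim: q => [|q IH]; first by rewrite mul0n add0n mul0r add0r.
  have := a_sub k (q * k + r)%N k0; rewrite addn_gt0 r0 orbT => /(_ isT) IH'.
  by rewrite mulSn -addnA -natr1 mulrDl mul1r; lra.
have a_le n : (0 < n)%N -> (a n <= n%:R * (k%:R^-1 * a k) + M)%R.
  (* Subadditivity is available at positive indices only. Dividing [n.-1] instead of [n] makes the
     remainder range over 1, ..., [k]. *)
  move=> n0; pose q := (n.-1 %/ k)%N; pose r := (n.-1 %% k).+1.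
  have nE : n = (q * k + r)%N by rewrite addnS -divn_eq prednK.
  have rk : (r < k.+1)%N by rewrite ltnS ltn_pmod.
  have ar : (a r <= \sum_(r < k.+1) `|a r|)%R.
    rewrite (bigD1 (Ordinal rk))//= (le_trans (ler_norm _))// lerDl.
    by apply: sumr_ge0.
  rewrite {1}nE (le_trans (a_mul _ _ _))// addrA -lerBlDr.
  have rak : (- (r%:R * (k%:R^-1 * a k)) <= `|a k|)%R.
    rewrite (le_trans (ler_norm _))// normrN mulrA normrM ler_piMl//.
    by rewrite ger0_norm ?divr_ge0// ler_pdivrMr// mul1r ler_nat -ltnS.
  have qE : (q%:R * a k = n%:R * (k%:R^-1 * a k) - r%:R * (k%:R^-1 * a k))%R.
    by rewrite nE natrD natrM; field; rewrite gt_eqF.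
  by rewrite qE; lra.
have M0 : (0 <= M)%R by rewrite addr_ge0// sumr_ge0.
near=> n.
have n0 : (0 < n)%N by near: n; exists 1%N.
have nR : (0 < n%:R :> R)%R by rewrite ltr0n.
have Sn : S (n%:R^-1 * a n)%R by exists n.
have Mn : (n%:R^-1 * M <= e / 2)%R.
  rewrite mulrC ler_pdivrMr// mulrC -ler_pdivrMr//.
  by near: n; exact: nbhs_infty_ger.
have nV : (0 < n%:R^-1 :> R)%R by rewrite invr_gt0.
have := a_le _ n0; rewrite -(ler_pM2l nV).
rewrite mulrDr mulKf ?gt_eqF// => an.
have lan := ge_inf infS.2 Sn.
rewrite ler_norml; apply/andP; split; lra.
Unshelve. all: by end_near. Qed.

Lemma fekete_sup (R : realType) (a : nat -> R) (c : R) :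
  (forall n m, (0 < n)%N -> (0 < m)%N -> a n + a m <= a (n + m)%N)%R ->
  (forall n, (0 < n)%N -> n%:R^-1 * a n <= c)%R ->
  (n%:R^-1 * a n)%R @[n --> \oo] -->
    sup [set (n%:R^-1 * a n)%R | n in [set n | (0 < n)%N]].
Proof.
move=> a_sup a_ub.
have /cvgN : (n%:R^-1 * - a n)%R @[n --> \oo] -->
    inf [set (n%:R^-1 * - a n)%R | n in [set n | (0 < n)%N]].
  apply: (@fekete _ _ (- c)%R) => [n m n0 m0|n n0].
    by rewrite -opprD lerN2 a_sup.
  by rewrite mulrN lerN2 a_ub.
rewrite (_ : - _ = fun n => n%:R^-1 * a n)%R; last first.
  by apply/funext => n /=; rewrite /GRing.opp/= mulrN opprK.
rewrite /inf opprK (_ : -%R @` _ =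
  [set (n%:R^-1 * a n)%R | n in [set n | (0 < n)%N]])//.
apply/seteqP; split=> [_ [_ [n n0 <-] <-]|_ [n n0 <-]].
  by exists n => //; rewrite mulrN opprK.
by exists (n%:R^-1 * - a n)%R; [exists n|rewrite mulrN opprK].
Qed.

(** * Cumulants of a bounded random variable *)

(** Convexity of exp between [x - k] and [y - l], multiplied by the exponential of the averaged
    shift. With cumulants as shifts, the two shifted exponentials have expectation 1. *)
Lemma expR_convex_shift (R : realType) (x y k l t : R) :
  (0 <= t)%R -> (t <= 1)%R ->
  (expR (t * x + (1 - t) * y) <= expR (t * k + (1 - t) * l) *
    (t * (expR (- k) * expR x)) +
    expR (t * k + (1 - t) * l) * ((1 - t) * (expR (- l) * expR y)))%R.
Proof.
move=> t0 t1.
have h := @convex_expR R (Itv01 t0 t1) (- k + x)%R (- l + y)%R.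
rewrite !convRE/= in h.
rewrite (_ : t * x + (1 - t) * y = (t * k + (1 - t) * l)
    + (t * (- k + x) + (1 - t) * (- l + y)))%R; last by ring.
by rewrite expRD -mulrDr ler_pM2l ?expR_gt0// -!expRD.
Qed.

Section cumulant.
Context (R : realType) (d : measure_display) (Omega : measurableType d)
  (P : probability Omega R).

(** The logarithmic moment generating function; for [Y] the logarithm of [L_n] it is the logarithm
    of the [q]-th moment of [L_n]. *)
Definition cumulant (Y : Omega -> R) (q : R) : R :=
  ln (fine (\int[P]_w (expR (q * Y w))%:E)).

Context (Y : Omega -> R) (c : R) (mY : measurable_fun [set: Omega] Y)
  (Y0c : forall w, (0 <= Y w <= c)%R).

Let mexp q : measurable_fun [set: Omega] (fun w => (expR (q * Y w))%:E).
Proof.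
apply/measurable_EFinP; apply: measurableT_comp => //.
exact: measurable_funM.
Qed.

Let exp_moment_bounds q :
  (expR (Num.min 0 (q * c)))%:E <= \int[P]_w (expR (q * Y w))%:E
  <= (expR (Num.max 0 (q * c)))%:E.
Proof.
have cstE (x : R) : x%:E = \int[P]_w x%:E.
  by rewrite integral_cst//= probability_setT mule1.
apply/andP; split.
- rewrite cstE; apply: ge0_le_integral => //= w _.
  rewrite lee_fin ler_expR; have /andP[Y0 Yc] := Y0c w; rewrite ge_min.
  have [q0|q0] := leP 0%R q; first by rewrite mulr_ge0.
  by rewrite ler_nM2l// Yc orbT.
- rewrite [leRHS]cstE; apply: ge0_le_integral => //= w _.
  rewrite lee_fin ler_expR; have /andP[Y0 Yc] := Y0c w; rewrite le_max.
  have [q0|q0] := leP 0%R q; first by rewrite ler_wpM2l// orbT.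
  by rewrite nmulr_rle0// Y0.
Qed.

(** Boundedness of [Y] makes the moment finite and positive, so neither [fine] nor [ln] falls back
    on a default value. *)
Lemma expR_cumulant q :
  \int[P]_w (expR (q * Y w))%:E = (expR (cumulant Y q))%:E.
Proof.
have /andP[lb ub] := exp_moment_bounds q.
have fin : \int[P]_w (expR (q * Y w))%:E \is a fin_num.
  by rewrite ge0_fin_numE ?integral_ge0// (le_lt_trans ub)// ltry.
rewrite lnK ?fineK// posrE -lte_fin fineK// (lt_le_trans _ lb)//.
by rewrite lte_fin expR_gt0.
Qed.

Lemma cumulant_bounds q :
  (Num.min 0 (q * c) <= cumulant Y q <= Num.max 0 (q * c))%R.
Proof.
by have := exp_moment_bounds q; rewrite expR_cumulant !lee_fin !ler_expR.
Qed.

(* Integrating the convexity inequality of exp between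
   p Y - cumulant p and q Y - cumulant q yields Hoelder's inequality. *)
Lemma cumulant_convex (p q t : R) : (0 <= t <= 1)%R ->
  (cumulant Y (t * p + (1 - t) * q) <=
   t * cumulant Y p + (1 - t) * cumulant Y q)%R.
Proof.
move=> /andP[t0 t1]; have t1' : (0 <= 1 - t)%R by rewrite subr_ge0.
pose A := expR (t * cumulant Y p + (1 - t) * cumulant Y q).
pose a := (A * t * expR (- cumulant Y p))%R.
pose b := (A * (1 - t) * expR (- cumulant Y q))%R.
have A0 : (0 <= A)%R by rewrite expR_ge0.
have a0 : (0 <= a)%R by rewrite !mulr_ge0 ?expR_ge0.
have b0 : (0 <= b)%R by rewrite !mulr_ge0 ?expR_ge0.
have aE : (a * expR (cumulant Y p) = A * t)%R.
  by rewrite /a -mulrA -expRD addNr expR0 mulr1.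
have bE : (b * expR (cumulant Y q) = A * (1 - t))%R.
  by rewrite /b -mulrA -expRD addNr expR0 mulr1.
have expA w : (expR ((t * p + (1 - t) * q) * Y w) <=
    a * expR (p * Y w) + b * expR (q * Y w))%R.
  have h := expR_convex_shift (p * Y w) (q * Y w)
    (cumulant Y p) (cumulant Y q) t0 t1.
  rewrite -/A !mulrA -/a -/b in h; apply: le_trans h.
  by rewrite mulrDl -!mulrA.
rewrite -ler_expR -/A -lee_fin -expR_cumulant.
clearbody a b A.
apply: (@le_trans _ _ (\int[P]_w (a%:E * (expR (p * Y w))%:E
    + b%:E * (expR (q * Y w))%:E))).
  apply: ge0_le_integral => //.
  - by apply: emeasurable_funD; exact: measurable_funeM.
  - by move=> w _; rewrite -!EFinM -EFinD lee_fin.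
rewrite ge0_integralD//; last 4 first.
- by move=> w _; rewrite mule_ge0.
- exact: measurable_funeM.
- by move=> w _; rewrite mule_ge0.
- exact: measurable_funeM.
rewrite !ge0_integralZl_EFin// !expR_cumulant -(EFinM a) -(EFinM b).
rewrite -EFinD lee_fin.
by rewrite aE bE -mulrDr addrC subrK mulr1.
Qed.

(** Markov's inequality for [expR (q * Y)] at level [expR y]. Stating the hypothesis for [q * Y]
    lets one lemma serve upper tails with [q >= 0] and lower tails with [q <= 0]. *)
Lemma cumulant_markov (E : set Omega) (q y : R) : measurable E ->
  (forall w, E w -> (y <= q * Y w)%R) ->
  P E <= (expR (cumulant Y q - y))%:E.
Proof.
move=> mE Ey; rewrite expRD mulrC EFinM expRN lee_pdivlMl ?expR_gt0//.
rewrite -(integral_cst P mE (expR y)%:E).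
apply: (@le_trans _ _ (\int[P]_(w in E) (expR (q * Y w))%:E)); last first.
  apply: (@le_trans _ _ (\int[P]_w (expR (q * Y w))%:E)).
    exact: ge0_subset_integral.
  by rewrite expR_cumulant.
apply: ge0_le_integral => //.
- by move=> w _; rewrite lee_fin expR_ge0.
- exact: measurable_funTS.
- by move=> w Ew; rewrite lee_fin ler_expR Ey.
Qed.

End cumulant.

(** * Growth rates for an abstract sequence with sub- and superadditive cumulants *)

(** An upper limit depends on tails only, so the comparison may fail at index 0, where no moment
    bound is available. *)
Lemma limn_esup_le_lim (R : realType) (v u : (\bar R)^nat) (l : \bar R) :
  (forall n, (0 < n)%N -> v n <= u n) -> u @ \oo --> l -> limn_esup v <= l.
Proof.
move=> vu ul; rewrite limn_esup_lim -(cvg_lim _ (cvg_esups ul))//.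
apply: lee_lim; [exact: is_cvg_esups|exact: is_cvg_esups|].
near=> n; apply: ge_ereal_sup => _ [k /= nk <-].
apply: (@le_trans _ _ (u k)); last by apply: ereal_sup_ubound; exists k.
by apply: vu; rewrite (leq_trans _ nk)//; near: n; exists 1%N.
Unshelve. all: by end_near. Qed.

Section growth_rate.
Context (R : realType) (d : measure_display) (Omega : measurableType d)
  (P : probability Omega R) (Y : nat -> Omega -> R) (c : R)
  (mY : forall n, (0 < n)%N -> measurable_fun [set: Omega] (Y n))
  (Y_bound : forall n w, (0 < n)%N -> (0 <= Y n w <= n%:R * c)%R)
  (Y_sub : forall (q : R) n m, (0 <= q)%R -> (0 < n)%N -> (0 < m)%N ->
    (cumulant P (Y (n + m)%N) q <= cumulant P (Y n) q + cumulant P (Y m) q)%R)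
  (Y_sup : forall (q : R) n m, (q < 0)%R -> (0 < n)%N -> (0 < m)%N ->
    (cumulant P (Y n) q + cumulant P (Y m) q <= cumulant P (Y (n + m)%N) q)%R).

Definition rate (q : R) (n : nat) : R := (n%:R^-1 * cumulant P (Y n) q)%R.

Lemma rate_bounds (q : R) n : (0 < n)%N ->
  (Num.min 0 (q * c) <= rate q n <= Num.max 0 (q * c))%R.
Proof.
move=> n0; have nR : (0 < n%:R :> R)%R by rewrite ltr0n.
have := cumulant_bounds P (mY n0) (fun w => Y_bound w n0) q.
rewrite (_ : q * (n%:R * c) = n%:R * (q * c))%R; last by ring.
have n_ge0 : (0 <= n%:R :> R)%R by rewrite ler0n.
have := minr_pMr 0%R (q * c)%R n_ge0; have := maxr_pMr 0%R (q * c)%R n_ge0.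
rewrite mulr0 => <- <-; rewrite /rate [(_^-1 * _)%R]mulrC.
by rewrite ler_pdivlMr// ler_pdivrMr// ![(_ * n%:R)%R]mulrC.
Qed.

Lemma rate_cvg_inf (q : R) : (0 <= q)%R -> rate q @ \oo -->
  inf [set rate q n | n in [set n | (0 < n)%N]].
Proof.
move=> q0; apply: (@fekete R (fun n => cumulant P (Y n) q)
  (Num.min 0 (q * c))%R) => [n m n0 m0|n n0].
  exact: Y_sub.
by have /andP[] := rate_bounds q n0.
Qed.

Lemma rate_cvg_sup (q : R) : (q < 0)%R -> rate q @ \oo -->
  sup [set rate q n | n in [set n | (0 < n)%N]].
Proof.
move=> q0; apply: (@fekete_sup R (fun n => cumulant P (Y n) q)
  (Num.max 0 (q * c))%R) => [n m n0 m0|n n0].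
  exact: Y_sup.
by have /andP[] := rate_bounds q n0.
Qed.

Lemma is_cvg_rate (q : R) : cvgn (rate q).
Proof.
by have [/rate_cvg_inf|/rate_cvg_sup] := leP 0%R q; exact: cvgP.
Qed.

Definition limit_rate q : R := limn (rate q).

Lemma limit_rate_bounds (q : R) :
  (Num.min 0 (q * c) <= limit_rate q <= Num.max 0 (q * c))%R.
Proof.
apply/andP; split; [apply: limr_ge|apply: limr_le]; try exact: is_cvg_rate;
  by near=> n; have /andP[] : (Num.min 0 (q * c) <= rate q n
    <= Num.max 0 (q * c))%R by apply: rate_bounds; near: n; exists 1%N.
Unshelve. all: by end_near. Qed.

Lemma ereal_inf_rate (q : R) : (0 <= q)%R ->
  ereal_inf [set (rate q n)%:E | n in [set n | (0 < n)%N]] = (limit_rate q)%:E.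
Proof.
move=> q0; rewrite /limit_rate (cvg_lim _ (rate_cvg_inf q0))// -ereal_inf_EFin.
- by rewrite image_comp.
- exists (Num.min 0 (q * c))%R => _ [n n0 <-].
  by have /andP[] := rate_bounds q n0.
- by exists (rate q 1), 1%N.
Qed.

Lemma ereal_sup_rate (q : R) : (q < 0)%R ->
  ereal_sup [set (rate q n)%:E | n in [set n | (0 < n)%N]] = (limit_rate q)%:E.
Proof.
move=> q0; rewrite /limit_rate (cvg_lim _ (rate_cvg_sup q0))// -ereal_sup_EFin.
- by rewrite image_comp.
- exists (Num.max 0 (q * c))%R => _ [n n0 <-].
  by have /andP[] := rate_bounds q n0.
- by exists (rate q 1), 1%N.
Qed.

Lemma limit_rate_convex (p q t : R) : (0 <= t <= 1)%R ->
  (limit_rate (t * p + (1 - t) * q) <=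
   t * limit_rate p + (1 - t) * limit_rate q)%R.
Proof.
move=> t01; have cvgE : (t * rate p n + (1 - t) * rate q n)%R @[n --> \oo] -->
    (t * limit_rate p + (1 - t) * limit_rate q)%R.
  by apply: cvgD; apply: cvgM; [exact: cvg_cst|exact: is_cvg_rate
    |exact: cvg_cst|exact: is_cvg_rate].
rewrite -(cvg_lim _ cvgE)//.
apply: ler_lim; [exact: is_cvg_rate|exact: cvgP cvgE|].
near=> n; have n0 : (0 < n)%N by near: n; exists 1%N.
rewrite /rate [X in (_ <= X + _)%R]mulrCA [X in (_ <= _ + X)%R]mulrCA -mulrDr.
rewrite ler_pM2l ?invr_gt0 ?ltr0n//.
exact: (cumulant_convex P (mY n0) (fun w => Y_bound w n0)).
Unshelve. all: by end_near. Qed.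

(** Chernoff's bound for a single exponent [q] of either sign; optimizing over [q] is left to the
    applications. *)
Lemma limn_esup_tail (E : nat -> set Omega) (q x : R) :
  (forall n, (0 < n)%N -> measurable (E n)) ->
  (forall n w, (0 < n)%N -> E n w -> (n%:R * (q * x) <= q * Y n w)%R) ->
  limn_esup (fun n => (n%:R^-1)%:E * lne (P (E n))) <=
  (limit_rate q - q * x)%:E.
Proof.
move=> mE Eq; apply: (@limn_esup_le_lim _ _ (fun n => (rate q n - q * x)%:E)).
  move=> n n0; have nR : (0 < n%:R :> R)%R by rewrite ltr0n.
  have markov := cumulant_markov P (mY n0) (fun w => Y_bound w n0) (mE n n0)
    (fun w => Eq n w n0).
  have h : lne (P (E n)) <= (cumulant P (Y n) q - n%:R * (q * x))%:E.
    rewrite -[leRHS]expeRK lee_lne//= in_itv/= ?measure_ge0 ?leey//.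
    by rewrite lee_fin expR_ge0.
  rewrite lee_pdivrMl// -EFinM; apply: le_trans h _.
  by rewrite lee_fin mulrBr /rate mulVKf ?gt_eqF.
apply: cvg_EFin; first by near=> n.
apply: cvgB; [exact: is_cvg_rate|exact: cvg_cst].
Unshelve. all: by end_near. Qed.

End growth_rate.

(** * Application to line counts of random compositions *)

Section line_counts.
Context (R : realType) (d : nat) (K : set 'rV[R]_d) (dT : measure_display)
  (Theta : measurableType dT) (Phi : Theta -> 'rV[R]_d -> 'rV[R]_d) (B : R)
  (K_polytope : polytope K) (K_nonempty : K !=set0)
  (Phi_K : forall theta, Phi theta @` K `<=` K)
  (L_measurable : measurable_line_counts K Phi) (B_ge1 : (1 <= B)%R)
  (L_bound : forall theta, line_count (Phi theta) K <= B%:E).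

Lemma compose_maps_cat (s1 s2 : seq Theta) :
  compose_maps Phi (s1 ++ s2) = compose_maps Phi s2 \o compose_maps Phi s1.
Proof.
rewrite /compose_maps foldl_cat; move: (foldl _ id s1) => g.
(* The fold accumulates the composed map, so the induction must run over an arbitrary accumulator
   [h]. *)
suff H h : foldl (fun f w => Phi w \o f) (h \o g) s2 =
  foldl (fun f w => Phi w \o f) h s2 \o g by exact: (H id).
by elim: s2 h => // w s IH h; exact: (IH (Phi w \o h)).
Qed.

Lemma compose_maps_sub (s : seq Theta) : compose_maps Phi s @` K `<=` K.
Proof.
elim/last_ind: s => [_ [x Kx <-]//|s w IH _ [x Kx <-]].
rewrite -cats1 compose_maps_cat; apply: Phi_K.
by exists (compose_maps Phi s x) => //; apply: IH; exists x.
Qed.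

Lemma line_count_compose_cat (s1 s2 : seq Theta) :
  line_count (compose_maps Phi (s1 ++ s2)) K <=
  line_count (compose_maps Phi s1) K * line_count (compose_maps Phi s2) K.
Proof.
rewrite compose_maps_cat; apply: line_count_comp => //.
exact: compose_maps_sub.
Qed.

Lemma line_count_compose_bound (s : seq Theta) : (0 < size s)%N ->
  line_count (compose_maps Phi s) K <= (B ^+ size s)%:E.
Proof.
have count_ge0 f : 0 <= line_count f K.
  by apply: le_trans (line_count_ge1 f K_nonempty); rewrite lee_fin ler01.
elim: s => // w [_ _|w' s IH _]; first exact: L_bound.
apply: le_trans (line_count_compose_cat [:: w] (w' :: s)) _.
by rewrite exprS EFinM; apply: lee_pmul => //; [exact: L_bound|exact: IH].
Qed.

(** It lives on parameter tuples, so that the logarithmic count of any block is this one function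
    evaluated at the block, and the laws of blocks apply to it. *)
Definition log_count (n : nat) (t : n.-tuple Theta) : R :=
  ln (fine (line_count (compose_maps Phi t) K)).

Lemma line_count_log_count (n : nat) (t : n.-tuple Theta) : (0 < n)%N ->
  line_count (compose_maps Phi t) K = (expR (log_count t))%:E.
Proof.
move=> n0; have lb := line_count_ge1 (compose_maps Phi t) K_nonempty.
have ub : line_count (compose_maps Phi t) K <= (B ^+ size t)%:E.
  by apply: line_count_compose_bound; rewrite size_tuple.
have fin : line_count (compose_maps Phi t) K \is a fin_num.
  by rewrite ge0_fin_numE ?(le_lt_trans ub) ?ltry// (le_trans _ lb).
rewrite /log_count lnK ?fineK// posrE -lte_fin fineK//.
by rewrite (lt_le_trans _ lb).
Qed.

Lemma log_count_bounds (n : nat) (t : n.-tuple Theta) : (0 < n)%N ->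
  (0 <= log_count t <= n%:R * ln B)%R.
Proof.
move=> n0; have B0 : (0 < B)%R by rewrite (lt_le_trans _ B_ge1).
apply/andP; split.
- rewrite -ler_expR expR0 -lee_fin -line_count_log_count//.
  exact: line_count_ge1.
- rewrite -ler_expR expRM_natl lnK ?posrE// -lee_fin -line_count_log_count//.
  rewrite -[X in (B ^+ X)%R](size_tuple t).
  by apply: line_count_compose_bound; rewrite size_tuple.
Qed.

Lemma measurable_log_count (n : nat) : (0 < n)%N ->
  measurable_fun [set: n.-tuple Theta] (@log_count n).
Proof.
move=> n0; apply: measurableT_comp => //.
apply/measurable_EFinP; apply: eq_measurable_fun (L_measurable n0) => t _ /=.
by rewrite line_count_log_count.
Qed.

(** Equating the underlying sequences avoids a cast between tuple types. *)
Lemma log_count_cat (n m : nat) (s : n.-tuple Theta) (t : m.-tuple Theta)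
    (r : (n + m).-tuple Theta) : (0 < n)%N -> (0 < m)%N ->
  r = s ++ t :> seq Theta -> (log_count r <= log_count s + log_count t)%R.
Proof.
move=> n0 m0 rE; have nm0 : (0 < n + m)%N by rewrite addn_gt0 n0.
have expE (x y z : \bar R) (a b c : R) : x = (expR a)%:E -> y = (expR b)%:E ->
    z = (expR c)%:E -> x <= y * z -> (a <= b + c)%R.
  by move=> -> -> ->; rewrite -EFinM lee_fin -expRD ler_expR.
apply: (expE _ _ _ _ _ _ (line_count_log_count r nm0)
  (line_count_log_count s n0) (line_count_log_count t m0)).
by rewrite rE; exact: line_count_compose_cat.
Qed.

Section random.
Context (dO : measure_display) (Omega : measurableType dO)
  (P : probability Omega R) (omega : nat -> Omega -> Theta)
  (omega_iid : iid P omega).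

Lemma val_block (a n : nat) (w : Omega) :
  block omega a n w = [seq omega i w | i <- iota a n] :> seq Theta.
Proof.
rewrite -[X in iota X](addn0 a) iotaDl -map_comp -val_enum_ord -map_comp /=.
exact: eq_map.
Qed.

Definition log_L (n : nat) (w : Omega) : R := log_count (block omega 0 n w).

Lemma L_nE (n : nat) (w : Omega) : (0 < n)%N ->
  L_n K Phi omega n w = (expR (log_L n w))%:E.
Proof.
by move=> n0; rewrite -line_count_log_count// /L_n /Phi_n val_block.
Qed.

Lemma measurable_log_L (n : nat) : (0 < n)%N ->
  measurable_fun [set: Omega] (log_L n).
Proof.
move=> n0; apply: measurableT_comp; first exact: measurable_log_count.
exact: (measurable_block omega_iid).
Qed.

Lemma log_L_bounds (n : nat) (w : Omega) : (0 < n)%N ->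
  (0 <= log_L n w <= n%:R * ln B)%R.
Proof. exact: log_count_bounds. Qed.

Let measurable_exp_count (q : R) (n : nat) : (0 < n)%N ->
  measurable_fun [set: n.-tuple Theta] (fun t => (expR (q * log_count t))%:E).
Proof.
move=> n0; apply/measurable_EFinP; apply: measurableT_comp => //.
by apply: measurable_funM => //; exact: measurable_log_count.
Qed.

Let cumulantE (n : nat) (q : R) (n0 : (0 < n)%N) :=
  expR_cumulant P (measurable_log_L n0) (fun w => log_L_bounds w n0) q.

(** Independence factors the expectation; the cumulant of [log_L m] appears because the second block
    has the law of the first [m] parameters. *)
Let integral_blocks (n m : nat) (q : R) : (0 < n)%N -> (0 < m)%N ->
  \int[P]_w (expR (q * log_L n w) * expR (q * log_count (block omega n m w)))%:E
  = (expR (cumulant P (log_L n) q + cumulant P (log_L m) q))%:E.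
Proof.
move=> n0 m0; have exp_ge0 k (t : k.-tuple Theta) :
    0 <= (expR (q * log_count t))%:E by rewrite lee_fin expR_ge0.
have := integral_block_prod omega_iid (measurable_exp_count q n0)
  (measurable_exp_count q m0) (@exp_ge0 n) (@exp_ge0 m).
rewrite [X in _ = X * _](cumulantE q n0) [X in _ = _ * X](cumulantE q m0).
by rewrite -[X in _ = X -> _]EFinM -expRD.
Qed.

Let log_L_add (n m : nat) (w : Omega) : (0 < n)%N -> (0 < m)%N ->
  (log_L (n + m) w <= log_L n w + log_count (block omega n m w))%R.
Proof.
by move=> n0 m0; apply: log_count_cat => //; rewrite !val_block iotaD map_cat.
Qed.

Let measurable_exp_L (n : nat) (q : R) : (0 < n)%N ->
  measurable_fun [set: Omega] (fun w => (expR (q * log_L n w))%:E).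
Proof.
move=> n0; apply/measurable_EFinP; apply: measurableT_comp => //.
by apply: measurable_funM => //; exact: measurable_log_L.
Qed.

Let measurable_exp_blocks (n m : nat) (q : R) : (0 < n)%N -> (0 < m)%N ->
  measurable_fun [set: Omega] (fun w =>
    (expR (q * log_L n w) * expR (q * log_count (block omega n m w)))%:E).
Proof.
move=> n0 m0; apply/measurable_EFinP; apply: measurable_funM.
  exact/measurable_EFinP/measurable_exp_L.
apply/measurable_EFinP; apply: (measurableT_comp (measurable_exp_count q m0)).
exact: (measurable_block omega_iid).
Qed.

Lemma cumulant_log_L_sub (q : R) (n m : nat) :
  (0 <= q)%R -> (0 < n)%N -> (0 < m)%N ->
  (cumulant P (log_L (n + m)) q <=
   cumulant P (log_L n) q + cumulant P (log_L m) q)%R.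
Proof.
move=> q0 n0 m0; have nm0 : (0 < n + m)%N by rewrite addn_gt0 n0.
suff : \int[P]_w (expR (q * log_L (n + m) w))%:E <= \int[P]_w
    (expR (q * log_L n w) * expR (q * log_count (block omega n m w)))%:E.
  by rewrite (cumulantE q nm0) (integral_blocks q n0 m0) lee_fin ler_expR.
apply: ge0_le_integral => //.
- exact: measurable_exp_L.
- exact: measurable_exp_blocks.
- by move=> w _; rewrite lee_fin -expRD ler_expR -mulrDr ler_wpM2l// log_L_add.
Qed.

(** A negative [q] reverses the pointwise inequality [log_L_add], while the factorization over the
    two blocks is the same. *)
Lemma cumulant_log_L_sup (q : R) (n m : nat) :
  (q < 0)%R -> (0 < n)%N -> (0 < m)%N ->
  (cumulant P (log_L n) q + cumulant P (log_L m) q <=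
   cumulant P (log_L (n + m)) q)%R.
Proof.
move=> q0 n0 m0; have nm0 : (0 < n + m)%N by rewrite addn_gt0 n0.
suff : \int[P]_w (expR (q * log_L n w) *
      expR (q * log_count (block omega n m w)))%:E <=
    \int[P]_w (expR (q * log_L (n + m) w))%:E.
  by rewrite (cumulantE q nm0) (integral_blocks q n0 m0) lee_fin ler_expR.
apply: ge0_le_integral => //.
- exact: measurable_exp_blocks.
- exact: measurable_exp_L.
- by move=> w _; rewrite lee_fin -expRD ler_expR -mulrDr ler_nM2l// log_L_add.
Qed.

Lemma log_momentE (q : R) (n : nat) :
  log_moment P K Phi omega q n = (rate P log_L q n)%:E.
Proof.
(* At [n = 0] both sides vanish, because the inverse of 0 is 0 and multiplying by 0 gives 0 in the
   extended reals too. *)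
rewrite /log_moment /rate; have [->|n0] := posnP n.
  by rewrite invr0 mul0e mul0r.
under eq_integral do rewrite L_nE// poweR_EFin -expRM mulrC.
by rewrite cumulantE// lne_EFin ?expR_gt0// expRK.
Qed.

Lemma log_moment_cvg (q : R) :
  log_moment P K Phi omega q @ \oo --> (limit_rate P log_L q)%:E.
Proof.
rewrite (_ : log_moment _ _ _ _ q = EFin \o rate P log_L q); last first.
  by apply/funext => n; rewrite log_momentE.
apply: cvg_EFin; first by near=> n.
exact: (is_cvg_rate measurable_log_L log_L_bounds
  cumulant_log_L_sub cumulant_log_L_sup).
Unshelve. all: by end_near. Qed.

Lemma Lambda_lineE (q : R) :
  Lambda_line P K Phi omega q = (limit_rate P log_L q)%:E.
Proof. by apply: cvg_lim => //; exact: log_moment_cvg. Qed.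

Lemma Z_nE (n : nat) (w : Omega) : (0 < n)%N ->
  Z_n K Phi omega n w = (n%:R^-1 * log_L n w)%:E.
Proof. by move=> n0; rewrite /Z_n L_nE// lne_EFin ?expR_gt0// expRK. Qed.

Let measurable_Z (n : nat) : (0 < n)%N ->
  measurable_fun [set: Omega] (Z_n K Phi omega n).
Proof.
move=> n0; rewrite (_ : Z_n _ _ _ n = fun w => (n%:R^-1 * log_L n w)%:E).
  apply/measurable_EFinP; apply: measurable_funM => //.
  exact: measurable_log_L.
by apply/funext => w; rewrite Z_nE.
Qed.

Lemma limn_esup_Z_upper (x : R) :
  limn_esup (fun n =>
    (n%:R^-1)%:E * lne (P [set w | x%:E <= Z_n K Phi omega n w])) <=
  - I_line_plus P K Phi omega x.
Proof.
(* Carrying the minus sign across puts the supremum on the left, so it suffices to bound the tail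
   for each exponent separately. *)
rewrite leeNr; apply: ge_ereal_sup => _ [q /= q0 <-].
rewrite leeNr Lambda_lineE -EFinB -EFinN opprB.
apply: (limn_esup_tail measurable_log_L log_L_bounds
  cumulant_log_L_sub cumulant_log_L_sup) => [n n0|n w n0 /=].
  rewrite -[X in measurable X]setTI.
  exact: emeasurable_fun_c_infty measurableT (measurable_Z n0) _.
have nR : (0 < n%:R :> R)%R by rewrite ltr0n.
rewrite Z_nE// lee_fin ler_pdivlMl// => xY.
by rewrite mulrCA ler_wpM2l.
Qed.

Lemma limn_esup_Z_lower (x : R) :
  limn_esup (fun n =>
    (n%:R^-1)%:E * lne (P [set w | Z_n K Phi omega n w <= x%:E])) <=
  - I_line_minus P K Phi omega x.
Proof.
rewrite leeNr; apply: ge_ereal_sup => _ [q /= q0 <-].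
rewrite leeNr Lambda_lineE -EFinB -EFinN opprB.
apply: (limn_esup_tail measurable_log_L log_L_bounds
  cumulant_log_L_sub cumulant_log_L_sup) => [n n0|n w n0 /=].
  rewrite -[X in measurable X]setTI.
  exact: emeasurable_fun_infty_c measurableT (measurable_Z n0) _.
have nR : (0 < n%:R :> R)%R by rewrite ltr0n.
rewrite Z_nE// lee_fin ler_pdivrMl// => xY.
by rewrite mulrCA ler_wnM2l.
Qed.

End random.
End line_counts.

Theorem theorem2p3 (R : realType) (d : nat) (K : set 'rV[R]_d)
    (dT dO : measure_display) (Theta : measurableType dT)
    (Omega : measurableType dO) (P : probability Omega R)
    (Phi : Theta -> 'rV[R]_d -> 'rV[R]_d) (omega : nat -> Omega -> Theta)
    (B : R)
    (K_polytope : polytope K) (K_nonempty : K !=set0)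
    (Phi_pwa : forall theta : Theta, piecewise_affine_self_map K (Phi theta))
    (omega_iid : iid P omega)
    (L_measurable : measurable_line_counts K Phi)
    (B_ge1 : (1 <= B)%R)
    (L_bound : ereal_sup (range (fun theta => line_count (Phi theta) K))
               <= B%:E) :
  let u := log_moment P K Phi omega in
  let Lambda := Lambda_line P K Phi omega in
  let Z := Z_n K Phi omega in
  [/\ forall q : R, cvgn (u q),
      forall q : R, (0 <= q)%R ->
        Lambda q = ereal_inf [set u q n | n in [set n | (1 <= n)%N]],
      forall q : R, (q < 0)%R ->
        Lambda q = ereal_sup [set u q n | n in [set n | (1 <= n)%N]] &
  [/\ forall q : R, Lambda q \is a fin_num,
      convex_function [set: R^o] (fun q : R^o => fine (Lambda q)),
      forall q : R,
        (Num.min 0%R (q * ln B)%R)%:E <= Lambda q /\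
        Lambda q <= (Num.max 0%R (q * ln B)%R)%:E,
      forall x : R,
        limn_esup (fun n =>
          (n%:R^-1)%:E * lne (P [set w | x%:E <= Z n w]))
        <= - I_line_plus P K Phi omega x &
      forall x : R,
        limn_esup (fun n =>
          (n%:R^-1)%:E * lne (P [set w | Z n w <= x%:E]))
        <= - I_line_minus P K Phi omega x ]].
Proof.
have Phi_K theta : Phi theta @` K `<=` K by have [] := Phi_pwa theta.
have bound theta : line_count (Phi theta) K <= B%:E.
  by apply: le_trans L_bound; apply: ereal_sup_ubound; exists theta.
have mL := measurable_log_L K_polytope K_nonempty Phi_K L_measurable bound
  omega_iid.
have bL := log_L_bounds K_polytope K_nonempty Phi_K B_ge1 bound omega.
have subL := cumulant_log_L_sub K_polytope K_nonempty Phi_K L_measurable B_ge1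
  bound omega_iid.
have supL := cumulant_log_L_sup K_polytope K_nonempty Phi_K L_measurable B_ge1
  bound omega_iid.
have uE := log_momentE K_polytope K_nonempty Phi_K L_measurable B_ge1
  bound omega_iid.
have LE := Lambda_lineE K_polytope K_nonempty Phi_K L_measurable B_ge1
  bound omega_iid.
move=> u Lambda Z.
split; last split.
- move=> q; apply/cvg_ex; eexists.
  exact: (log_moment_cvg K_polytope K_nonempty Phi_K L_measurable B_ge1
    bound omega_iid).
- move=> q q0; rewrite /Lambda LE -(ereal_inf_rate mL bL subL q0).
  by congr (ereal_inf _); apply: eq_imagel => n _; rewrite /u uE.
- move=> q q0; rewrite /Lambda LE -(ereal_sup_rate mL bL supL q0).
  by congr (ereal_sup _); apply: eq_imagel => n _; rewrite /u uE.
- by move=> q; rewrite /Lambda LE.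
- move=> t p q _ _; rewrite convRE /Lambda !LE /=.
  apply: (limit_rate_convex mL bL subL supL).
  exact/andP.
- move=> q; rewrite /Lambda LE !lee_fin; apply/andP.
  exact: (limit_rate_bounds mL bL subL supL).
- exact: (limn_esup_Z_upper K_polytope K_nonempty Phi_K L_measurable B_ge1
    bound omega_iid).
- exact: (limn_esup_Z_lower K_polytope K_nonempty Phi_K L_measurable B_ge1
    bound omega_iid).
Qed.
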